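(* (BFSS solution $\mathbb{R}_t\times\mathbb{R}^2_\theta\times\mathbb{R}\times_\xi S^1\times S^2\times S^2$.) Let $Y_L^a,Y_R^a$, $a=1,2,3$, be Hermitian matrices forming two commuting fuzzy spheres, i.e. $$[Y_L^a,Y_L^b]=ic_L\sum_c\varepsilon^{abc}Y_L^c,\quad \sum_aY_L^aY_L^a=R_L^2\mathbf 1,\quad [Y_R^a,Y_R^b]=ic_R\sum_c\varepsilon^{abc}Y_R^c,\quad \sum_aY_R^aY_R^a=R_R^2\mathbf 1,\quad [Y_L^a,Y_R^b]=0,$$ with real constants $c_L,c_R,R_L,R_R$ chosen such that, for some $\xi\in\mathbb{R}$, $\sum_{b}\big([Y_L^b,[Y_L^b,Y]]+[Y_R^b,[Y_R^b,Y]]\big)=\xi^2Y$ for each of the six matrices $Y\in\{Y_L^a,Y_R^a\}$. Let $(U_3,X^3)$ be a fuzzy cylinder with radius $1$ and NC modulus $\xi$, and let $X^1,X^2$ be Hermitian matrices with $[X^1,X^2]=i\theta\mathbf 1$, $\theta\in\mathbb{R}$; assume that the spheres, the cylinder and the pair $(X^1,X^2)$ mutually commute. Let $\omega\in\mathbb{R}$ with $\omega^2=2\xi^2$, and define nine Hermitian time-dependent matrices by $$X^i(t)=X^i\ (i=1,2,3),\qquad X^{2a+2}(t)+\mathrm{i}\,X^{2a+3}(t)=(Y_L^a+\mathrm{i}\,Y_R^a)\,U_3\,e^{\mathrm{i}\omega t}\quad(a=1,2,3),$$ where $\mathrm{i}$ is the imaginary unit. Then these matrices solve the BFSS equations of motion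 $$\ddot X^a(t)+\sum_{b=1}^9[X^b(t),[X^b(t),X^a(t)]]=0\qquad\text{for all }a=1,\dots,9\text{ and }t\in\mathbb{R}.$$
   Context: Conventions: $\mathbf 1$ is the identity; $\varepsilon^{abc}$ is the Levi-Civita symbol. ''Matrices'' are operators on a separable Hilbert space; when they are unbounded, commutators and all identities are understood algebraically on a common invariant dense domain, so everything may be read as taking place in a unital complex $*$-algebra with involution $\dagger$. For a matrix $Z$ written as $Z=A+iB$ with $A,B$ Hermitian, $A=\tfrac12(Z+Z^\dagger)$ and $B=\tfrac1{2i}(Z-Z^\dagger)$. A dot denotes $d/dt$; the time dependence enters only through scalar factors $e^{\pm i\omega t}$. Fuzzy cylinder: a pair $(U,X)$ with $X=X^\dagger$ is a fuzzy cylinder with radius $R>0$ and NC modulus $\xi\in\mathbb{R}$ if $UU^\dagger=U^\dagger U=R^2\mathbf 1$, $[U,X]=\xi U$ and $[U^\dagger,X]=-\xi U^\dagger$. *)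

(* Defs.v *)
From HB Require Import structures.
From mathcomp Require Import all_boot all_order all_algebra.
From mathcomp Require Import complex.
From mathcomp Require Import all_classical all_reals all_analysis.
Set Implicit Arguments.
Unset Strict Implicit.
Unset Printing Implicit Defensive.
Import Order.TTheory GRing.Theory Num.Theory.
Import numFieldNormedType.Exports.
Local Open Scope classical_set_scope.
Local Open Scope complex_scope.
Local Open Scope ring_scope.

(* Unital *-algebras over C: the setting in which commutator identities between
   (possibly unbounded) operators on a common invariant domain are read. *)
HB.mixin Record isStarAlgebra (C : numClosedFieldType) A
    of GRing.Algebra C A := {
  dagger : A -> A;
  daggerK : involutive dagger;
  daggerD : forall x y : A, dagger (x + y) = dagger x + dagger y;
  daggerZ : forall (a : C) (x : A), dagger (a *: x) = a^* *: dagger x;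
  daggerM : forall x y : A, dagger (x * y) = dagger y * dagger x
}.

#[short(type="starAlgType")]
HB.structure Definition StarAlgebra (C : numClosedFieldType) :=
  { A of GRing.Algebra C A & isStarAlgebra C A }.

Section StarAlgebra.
Variables (C : numClosedFieldType) (A : starAlgType C).

Definition is_hermitian (x : A) : Prop := dagger x = x.

Definition commutator (x y : A) : A := x * y - y * x.

Definition commuting (S T : set A) : Prop :=
  forall x y, S x -> T y -> commutator x y = 0.

Lemma hermitian_decomposition (z x y : A) :
  is_hermitian x /\ is_hermitian y /\ x + 'i *: y = z <->
  x = 2^-1 *: (z + dagger z) /\ y = (2 * 'i)^-1 *: (z - dagger z).
Proof.
have i0 : 'i != 0 :> C by exact: neq0Ci.
have n2 : (2 : C) != 0 by rewrite pnatr_eq0.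
have dagN (w : A) : dagger (- w) = - dagger w.
  by rewrite -scaleN1r daggerZ rmorphN rmorph1 scaleN1r.
have twice (w : A) : 2^-1 *: (w + w) = w.
  by rewrite -mulr2n -(scaler_nat 2 w) scalerA mulVf // scale1r.
split=> [[hx [hy <-]]|[-> ->]].
  rewrite daggerD daggerZ hx hy conjCi scaleNr; split.
    by rewrite addrACA subrr addr0 twice.
  rewrite opprB addrC addrA subrK -[_ + _]mulr2n.
  by rewrite -(scaler_nat 2 ('i *: y)) !scalerA mulVf ?scale1r // mulf_neq0.
have cV (a : C) : a \is Num.real ->
    dagger (a *: (z + dagger z)) = a *: (z + dagger z).
  by move=> ar; rewrite daggerZ daggerD daggerK addrC (CrealP ar).
split; first by apply: cV; rewrite rpredV realn.
split.
  rewrite /is_hermitian daggerZ daggerD dagN daggerK fmorphV rmorphM /= conjCi.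
  by rewrite rmorph_nat mulrN invrN scaleNr -scalerN opprB.
rewrite scalerA invfM mulrCA divff // mulr1 -scalerDr addrACA subrr addr0.
by rewrite twice.
Qed.

End StarAlgebra.

Section TimeDerivative.
Variables (R : realType) (A : starAlgType R[i]).

(* exp(i x) for real x *)
Definition expi (x : R) : R[i] := cos x +i* sin x.

Definition is_derive_complex (f : R -> R[i]) (t : R) (df : R[i]) : Prop :=
  is_derive t 1 (fun s => complex.Re (f s)) (complex.Re df) /\
  is_derive t 1 (fun s => complex.Im (f s)) (complex.Im df).

(* A carries no topology. The time dependence of X enters through finitely many
   scalar coefficients, and d/dt differentiates these; the result does not
   depend on the chosen expansion, see is_time_derivative_unique. *)
Definition is_time_derivative (X dX : R -> A) : Prop :=
  exists (n : nat) (f df : 'I_n -> R -> R[i]) (M : 'I_n -> A),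
    [/\ forall k t, is_derive_complex (f k) t (df k t),
        forall t, X t = \sum_k f k t *: M k
      & forall t, dX t = \sum_k df k t *: M k].

Let is_time_derivative0 n (f df : 'I_n -> R -> R[i]) (M : 'I_n -> A) :
  (forall k t, is_derive_complex (f k) t (df k t)) ->
  (forall t, \sum_k f k t *: M k = 0) -> forall t, \sum_k df k t *: M k = 0.
Proof.
elim: n f df M => [|n IHn] f df M hf fM0 t; first by rewrite big_ord0.
have [[s [j fsj]]|f0] := pselect (exists s j, f j s != 0); last first.
  rewrite big1// => k _.
  have {}f0 s : f k s = 0.
    by apply: contrapT => /eqP fk; apply: f0; exists s, k.
  have [[_ d1] [_ d2]] := hf k t.
  suff -> : df k t = 0 by rewrite scale0r.
  apply/eqP; rewrite eq_complex -d1 -d2.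
  rewrite (_ : (fun s => complex.Re (f k s)) = cst 0); last first.
    by apply/funext => u; rewrite f0.
  rewrite (_ : (fun s => complex.Im (f k s)) = cst 0); last first.
    by apply/funext => u; rewrite f0.
  by rewrite derive_cst eqxx.
have ReB (z w : R[i]) : complex.Re (z - w) = complex.Re z - complex.Re w.
  by case: z w => ? ? [].
have ImB (z w : R[i]) : complex.Im (z - w) = complex.Im z - complex.Im w.
  by case: z w => ? ? [].
have ReM (z w : R[i]) : complex.Re (z * w) =
    complex.Re z * complex.Re w - complex.Im z * complex.Im w.
  by case: z w => ? ? [].
have ImM (z w : R[i]) : complex.Im (z * w) =
    complex.Re z * complex.Im w + complex.Im z * complex.Re w.
  by case: z w => ? ? [].
have [c Mj] : exists c, M j = - \sum_k c k *: M (lift j k).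
  exists (fun k => f (lift j k) s / f j s).
  have := fM0 s; rewrite (bigD1_ord j) //= => /eqP; rewrite addr_eq0 => /eqP e.
  rewrite -[M j]scale1r -(mulVf fsj) -scalerA e scalerN scaler_sumr.
  by congr (- _); apply: eq_bigr => k _; rewrite scalerA mulrC.
have red (g : 'I_n.+1 -> R[i]) :
    \sum_k g k *: M k = \sum_k (g (lift j k) - c k * g j) *: M (lift j k).
  rewrite (bigD1_ord j) //= Mj scalerN scaler_sumr addrC -sumrB.
  by apply: eq_bigr => k _; rewrite scalerBl scalerA mulrC.
rewrite red.
apply: (IHn (fun k u => f (lift j k) u - c k * f j u)
            (fun k u => df (lift j k) u - c k * df j u)) => [k u|u].
  have [d1 d2] := hf (lift j k) u; have [e1 e2] := hf j u.
  split.
    rewrite (_ : (fun s0 => _) = (fun u => complex.Re (f (lift j k) u)) -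
      (complex.Re (c k) *: (fun u => complex.Re (f j u)) -
       complex.Im (c k) *: (fun u => complex.Im (f j u)))); last first.
      by apply/funext => v; rewrite ReB ReM.
    by apply: is_derive_eq; rewrite ReB ReM opprD.
  rewrite (_ : (fun s0 => _) = (fun u => complex.Im (f (lift j k) u)) -
    (complex.Re (c k) *: (fun u => complex.Im (f j u)) +
     complex.Im (c k) *: (fun u => complex.Re (f j u)))); last first.
    by apply/funext => v; rewrite ImB ImM.
  by apply: is_derive_eq; rewrite ImB ImM.
by rewrite -(red (f^~ u)).
Qed.

Lemma is_time_derivative_unique (X dX dX' : R -> A) :
  is_time_derivative X dX -> is_time_derivative X dX' -> dX = dX'.
Proof.
move=> [n [f [df [M [hf XE dXE]]]]] [m [g [dg [N [hg XE' dXE']]]]].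
apply/funext => t; apply/eqP; rewrite -subr_eq0; apply/eqP.
pose glue T (a : 'I_n -> T) (b : 'I_m -> T) (k : 'I_(n + m)) :=
  match fintype.split k with inl i => a i | inr j => b j end.
have glueE (a : 'I_n -> R[i]) (b : 'I_m -> R[i]) :
    \sum_k glue _ a b k *: glue _ M (fun j => - N j) k =
    \sum_k a k *: M k - \sum_k b k *: N k.
  rewrite big_split_ord /= -sumrN; congr (_ + _); apply: eq_bigr => k _.
    by rewrite /glue (unsplitK (inl _ k)).
  by rewrite /glue (unsplitK (inr _ k)) scalerN.
rewrite dXE dXE' -glueE.
apply: (@is_time_derivative0 _
  (fun k u => glue _ (f^~ u) (g^~ u) k) (fun k u => glue _ (df^~ u) (dg^~ u) k)).
  by move=> k u; rewrite /glue; case: fintype.split => j; [exact: hf|exact: hg].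
by move=> u; rewrite glueE -XE -XE' subrr.
Qed.

Definition is_second_time_derivative (X ddX : R -> A) : Prop :=
  exists dX : R -> A, is_time_derivative X dX /\ is_time_derivative dX ddX.

End TimeDerivative.

Local Open Scope nat_scope.
Definition levi_civita (a b c : 'I_3) : int :=
  match val a, val b, val c with
  | 0, 1, 2 | 1, 2, 0 | 2, 0, 1 => 1%R
  | 0, 2, 1 | 2, 1, 0 | 1, 0, 2 => (- 1)%R
  | _, _, _ => 0%R
  end.
Local Close Scope nat_scope.

Section Configurations.
Variables (R : realType) (A : starAlgType R[i]).

Definition fuzzy_sphere (c r : R) (Y : 'I_3 -> A) : Prop :=
  [/\ forall a, is_hermitian (Y a),
      forall a b, commutator (Y a) (Y b) =
        ('i * c%:C) *: \sum_d (levi_civita a b d)%:~R *: Y d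
    & \sum_a Y a * Y a = (r ^+ 2)%:C%:A].

Definition fuzzy_cylinder (r xi : R) (U X : A) : Prop :=
  [/\ 0 < r, is_hermitian X,
      U * dagger U = (r ^+ 2)%:C%:A /\ dagger U * U = (r ^+ 2)%:C%:A,
      commutator U X = xi%:C *: U
    & commutator (dagger U) X = - xi%:C *: dagger U].

(* The ordinal k : 'I_9 stands for the matrix X^{k+1}. *)
Definition solves_BFSS (X : 'I_9 -> R -> A) : Prop :=
  exists ddX : 'I_9 -> R -> A,
    (forall a, is_second_time_derivative (X a) (ddX a)) /\
    (forall a t, ddX a t +
       \sum_b commutator (X b t) (commutator (X b t) (X a t)) = 0).

End Configurations.

(* Main.v *)
Require Import Defs.
From mathcomp Require Import all_boot all_order all_algebra.
From mathcomp Require Import complex.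
From mathcomp Require Import all_classical all_reals all_analysis.
From mathcomp Require Import ring.
Import Order.TTheory GRing.Theory Num.Theory.
Local Open Scope classical_set_scope.
Local Open Scope complex_scope.
Local Open Scope ring_scope.

(* Put Z_a = W_a V with W_a = L_a + iR_a and V = e^{i omega t} U_3, which is
   unitary and commutes with both spheres. The double commutators with the two
   Hermitian components of Z_b add up to half of
   [Z_b, [Z_b*, M]] + [Z_b*, [Z_b, M]]. Since [L_b, R_c] = 0, for M = Z_c both
   terms equal ([L_b, [L_b, L_c]] + i [R_b, [R_b, R_c]]) V, whose sum over b is
   xi^2 Z_c; X^3 contributes a second xi^2 Z_c, and the second derivative is
   - omega^2 Z_c = - 2 xi^2 Z_c. For M = X^3 the sum is a multiple of
   [Z_b, Z_b*], which vanishes. *)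

(** * Commutator and adjoint calculus in a *-algebra *)

Section Commutators.
Context {C : numClosedFieldType} {A : starAlgType C}.
Implicit Types (x y z u v : A) (k : C).

Lemma commutatorDl x y z :
  commutator (x + y) z = commutator x z + commutator y z.
Proof. by rewrite /commutator mulrDl mulrDr opprD addrACA. Qed.

Lemma commutatorDr x y z :
  commutator x (y + z) = commutator x y + commutator x z.
Proof. by rewrite /commutator mulrDl mulrDr opprD addrACA. Qed.

Lemma commutatorZl k x y : commutator (k *: x) y = k *: commutator x y.
Proof. by rewrite /commutator -scalerAl -scalerAr scalerBr. Qed.

Lemma commutatorZr k x y : commutator x (k *: y) = k *: commutator x y.
Proof. by rewrite /commutator -scalerAl -scalerAr scalerBr. Qed.

Lemma commutatorC x y : commutator x y = - commutator y x.
Proof. by rewrite /commutator opprB. Qed.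

Lemma commutatorNl x y : commutator (- x) y = - commutator x y.
Proof. by rewrite -scaleN1r commutatorZl scaleN1r. Qed.

Lemma commutatorNr x y : commutator x (- y) = - commutator x y.
Proof. by rewrite -scaleN1r commutatorZr scaleN1r. Qed.

Lemma commutator0r x : commutator x 0 = 0.
Proof. by rewrite /commutator mulr0 mul0r subrr. Qed.

Lemma commutatorxx x : commutator x x = 0.
Proof. exact: subrr. Qed.

Lemma commutatorA1 x k : commutator x k%:A = 0.
Proof. by rewrite /commutator mulr_algl mulr_algr subrr. Qed.

Lemma commutator_eq0 x y : commutator x y = 0 <-> GRing.comm x y.
Proof. by split=> [/subr0_eq//|xy]; apply/eqP; rewrite subr_eq0; apply/eqP. Qed.

Lemma commutator_eq0_sym x y : commutator x y = 0 -> commutator y x = 0.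
Proof. by move=> xy; rewrite commutatorC xy oppr0. Qed.

Lemma commutator_eq0M x y z :
  commutator x y = 0 -> commutator x z = 0 -> commutator x (y * z) = 0.
Proof. by rewrite !commutator_eq0; exact: commrM. Qed.

Lemma commutator_eq0_nested x y z :
  commutator x y = 0 -> commutator x z = 0 ->
  commutator x (commutator y z) = 0.
Proof.
move=> xy xz; rewrite {2}/commutator commutatorDr commutatorNr.
by rewrite !commutator_eq0M // subrr.
Qed.

(** The hypotheses let [v] pass [y] and [u] pass [x], so in both products the phase factors collect
    on the right, where they agree because [u] and [v] commute. *)
Lemma commutatorM x y u v :
  commutator v y = 0 -> commutator x u = 0 -> commutator v u = 0 ->
  commutator (x * v) (y * u) = commutator x y * (v * u).
Proof.
rewrite !commutator_eq0 => vy xu vu; rewrite /commutator mulrBl; congr (_ - _).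
  by rewrite -mulrA (mulrA v) vy !mulrA.
by rewrite vu -mulrA (mulrA u) -xu !mulrA.
Qed.

Lemma commutatorMl x v z :
  commutator x z = 0 -> commutator (x * v) z = x * commutator v z.
Proof.
rewrite commutator_eq0 => xz; rewrite /commutator mulrBr !mulrA.
by rewrite xz.
Qed.

Lemma daggerN x : dagger (- x) = - dagger x.
Proof. by rewrite -scaleN1r daggerZ rmorphN rmorph1 scaleN1r. Qed.

Lemma dagger0 : dagger 0 = 0 :> A.
Proof. by rewrite -(scale0r (0 : A)) daggerZ rmorph0 !scale0r. Qed.

Lemma dagger_sum (I : finType) (F : I -> A) :
  dagger (\sum_i F i) = \sum_i dagger (F i).
Proof. exact: (big_morph _ daggerD dagger0). Qed.

Lemma dagger_commutator x y :
  dagger (commutator x y) = - commutator (dagger x) (dagger y).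
Proof. by rewrite /commutator daggerD daggerN !daggerM opprB. Qed.

(** For Hermitian [x] the adjoint of [[x, y]] is [- [x, dagger y]]. Commutation with the spheres,
    the plane or the axis thereby passes to adjoints. *)
Lemma dagger_commutator_eq0 x y :
  is_hermitian x -> commutator x y = 0 -> commutator x (dagger y) = 0.
Proof.
move=> hx xy; apply: oppr_inj.
by rewrite oppr0 -{1}hx -dagger_commutator xy dagger0.
Qed.

(** The scalar is kept general so that the expansion serves both [k = 'i] and [k = - 'i]: the cross
    terms are odd in [k], the others even. *)
Lemma double_commutatorDB k x y z :
  commutator (x + k *: y) (commutator (x - k *: y) z) =
  (commutator x (commutator x z) - k ^+ 2 *: commutator y (commutator y z)) +
  k *: (commutator y (commutator x z) - commutator x (commutator y z)).
Proof.
have -> : commutator (x - k *: y) z = commutator x z - k *: commutator y z.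
  by rewrite commutatorDl commutatorNl commutatorZl.
have E t : commutator t (commutator x z - k *: commutator y z) =
    commutator t (commutator x z) - k *: commutator t (commutator y z).
  by rewrite commutatorDr commutatorNr commutatorZr.
rewrite commutatorDl commutatorZl !E.
rewrite !(scalerBr k (commutator y (commutator x z))) scalerA -expr2.
have swap (a b c d : A) : a - c + (b - d) = a - d + (b - c).
  by rewrite addrACA [- c - d]addrC addrACA.
by rewrite swap -scalerBr.
Qed.

(* The cross terms of the two products cancel, so the pair x + iy, x - iy
   contributes to a double commutator like the pair x, y. *)
Lemma double_commutator_pair x y z :
  commutator (x + 'i *: y) (commutator (x - 'i *: y) z) +
  commutator (x - 'i *: y) (commutator (x + 'i *: y) z) =
  2 *: (commutator x (commutator x z) + commutator y (commutator y z)).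
Proof.
have := double_commutatorDB (- 'i) x y z; rewrite !scaleNr opprK => ->.
rewrite double_commutatorDB sqrrN sqrCi !scaleN1r !opprK.
by rewrite addrACA subrr addr0 scaler_nat mulr2n.
Qed.
End Commutators.

(** * Commuting Hermitian families twisted by a unitary [v] *)

Section TwistedSpheres.
Context {C : numClosedFieldType} {A : starAlgType C} {I : finType}.
Variables (L R : I -> A) (v x3 : A) (e s : C).
Hypotheses (hL : forall a, is_hermitian (L a)).
Hypotheses (hR : forall a, is_hermitian (R a)).
Hypotheses (LR : forall a b, commutator (L a) (R b) = 0).
Hypotheses (vL : forall a, commutator v (L a) = 0).
Hypotheses (vR : forall a, commutator v (R a) = 0).
Hypotheses (v_unitl : v * dagger v = 1) (v_unitr : dagger v * v = 1).

(** Since [L a] and [R a] are Hermitian, [w' a] is the adjoint of [w a]. *)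
Let w a := L a + 'i *: R a.
Let w' a := L a - 'i *: R a.

Let RL a b : commutator (R a) (L b) = 0.
Proof. exact/commutator_eq0_sym. Qed.

Let comm_w u a : commutator u (L a) = 0 -> commutator u (R a) = 0 ->
  commutator u (w a) = 0 /\ commutator u (w' a) = 0.
Proof.
move=> uL uR; rewrite /w /w' !(commutatorDr _ (L a)) commutatorNr commutatorZr.
by rewrite uL uR scaler0 oppr0 addr0.
Qed.

Let vdL a : commutator (dagger v) (L a) = 0.
Proof. exact/commutator_eq0_sym/dagger_commutator_eq0/commutator_eq0_sym. Qed.

Let vdR a : commutator (dagger v) (R a) = 0.
Proof. exact/commutator_eq0_sym/dagger_commutator_eq0/commutator_eq0_sym. Qed.

Let vw a : commutator v (w a) = 0. Proof. by have [] := @comm_w v a. Qed.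
Let vw' a : commutator v (w' a) = 0. Proof. by have [] := @comm_w v a. Qed.
Let vdw a : commutator (dagger v) (w a) = 0.
Proof. by have [] := @comm_w (dagger v) a. Qed.
Let vdw' a : commutator (dagger v) (w' a) = 0.
Proof. by have [] := @comm_w (dagger v) a. Qed.

Let vvd : commutator v (dagger v) = 0.
Proof. by rewrite /commutator v_unitl v_unitr subrr. Qed.

(** The mixed terms vanish because the families commute. With [k] and [l] free, one formula covers
    [w] and [w'] in every combination. *)
Let commutator_ww b c (k l : C) :
  commutator (L b + k *: R b) (L c + l *: R c) =
  commutator (L b) (L c) + (k * l) *: commutator (R b) (R c).
Proof.
rewrite commutatorDl (commutatorDr (L b)) commutatorZr LR scaler0 addr0.
by rewrite commutatorZl commutatorDr RL add0r commutatorZr scalerA.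
Qed.

Let LcR b c : commutator (L b) (commutator (R b) (R c)) = 0.
Proof. exact: commutator_eq0_nested. Qed.

Let RcL b c : commutator (R b) (commutator (L b) (L c)) = 0.
Proof. exact: commutator_eq0_nested. Qed.

Let commutator_www b c (k l : C) :
  commutator (L b + k *: R b)
    (commutator (L b) (L c) + l *: commutator (R b) (R c)) =
  commutator (L b) (commutator (L b) (L c)) +
  (k * l) *: commutator (R b) (commutator (R b) (R c)).
Proof.
rewrite commutatorDl (commutatorDr (L b)) commutatorZr LcR scaler0 addr0.
by rewrite commutatorZl commutatorDr RcL add0r commutatorZr scalerA.
Qed.

Lemma dagger_twisted a :
  dagger ((L a + 'i *: R a) * v) = (L a - 'i *: R a) * dagger v.
Proof.
rewrite daggerM daggerD daggerZ hL hR conjCi scaleNr.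
exact/(commutator_eq0 _ _).1/vdw'.
Qed.

Let w'E a : w' a = L a + (- 'i) *: R a.
Proof. by rewrite scaleNr. Qed.

Let Nii : - 'i * 'i = 1 :> C.
Proof. by rewrite mulNr -expr2 sqrCi opprK. Qed.

Let twisted_nested b c :
  commutator (w b * v) (commutator (w' b * dagger v) (w c * v)) +
  commutator (w' b * dagger v) (commutator (w b * v) (w c * v)) =
  2 *: ((commutator (L b) (commutator (L b) (L c)) +
         'i *: commutator (R b) (commutator (R b) (R c))) * v).
Proof.
have nested u k : commutator u (L b) = 0 -> commutator u (R b) = 0 ->
    commutator u (L c) = 0 -> commutator u (R c) = 0 ->
    commutator u (commutator (L b) (L c) + k *: commutator (R b) (R c)) = 0.
  move=> uLb uRb uLc uRc; rewrite commutatorDr commutatorZr.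
  by rewrite !commutator_eq0_nested // scaler0 addr0.
have vdv := commutator_eq0_sym _ _ vvd.
have w'v := commutator_eq0_sym _ _ (vw' b).
have wv := commutator_eq0_sym _ _ (vw b).
have comm1 u : commutator u 1 = 0.
  by rewrite -[1]scale1r commutatorA1.
(* The inner commutators are [[L b, L c] + [R b, R c]] with phase [dagger v * v = 1], and
   [[L b, L c] - [R b, R c]] with phase [v * v]. The outer factor restores a single [v] in both
   cases, and the scalar on the [R] part is ['i * 1] in one and [(- 'i) * (- 1)] in the other, so
   the two summands are equal. *)
rewrite (@commutatorM _ _ (w' b) (w c)) // v_unitr.
rewrite (@commutatorM _ _ (w b) (w c)) ?commutatorxx //.
rewrite w'E /w !commutator_ww Nii -!expr2 sqrCi.
rewrite (@commutatorM _ _ _ _ 1) ?mulr1 ?comm1 //; last exact: nested.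
rewrite -w'E (@commutatorM _ _ (w' b)); [|exact: nested| |]; last 2 first.
- by rewrite expr2; exact: commutator_eq0M.
- by rewrite expr2; exact: commutator_eq0M.
rewrite (expr2 v) (mulrA (dagger v)) v_unitr mul1r w'E.
rewrite !commutator_www mulr1 mulrN1 opprK.
by rewrite scaler_nat mulr2n.
Qed.

Hypothesis eigL : forall a,
  \sum_b (commutator (L b) (commutator (L b) (L a)) +
          commutator (R b) (commutator (R b) (L a))) = e *: L a.
Hypothesis eigR : forall a,
  \sum_b (commutator (L b) (commutator (L b) (R a)) +
          commutator (R b) (commutator (R b) (R a))) = e *: R a.

(** [p b] and [q b] are the Hermitian components of the twisted matrix, given through [p + iq] and
    its adjoint [p - iq]. *)
Variables p q : I -> A.
Hypothesis pq : forall b, p b + 'i *: q b = (L b + 'i *: R b) * v.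
Hypothesis pq' : forall b, p b - 'i *: q b = (L b - 'i *: R b) * dagger v.

Let n2 : (2 : C) != 0. Proof. by rewrite pnatr_eq0. Qed.

Lemma twisted_eigen c :
  \sum_b (commutator (p b) (commutator (p b) ((L c + 'i *: R c) * v)) +
          commutator (q b) (commutator (q b) ((L c + 'i *: R c) * v))) =
  e *: ((L c + 'i *: R c) * v).
Proof.
apply: (scalerI n2); rewrite scaler_sumr.
under eq_bigr => b _ do
  rewrite -double_commutator_pair pq pq' twisted_nested.
rewrite -scaler_sumr -mulr_suml big_split /= -scaler_sumr; congr (_ *: _).
(* As [[R b, L c] = 0], the joint eigenvalue equation reduces to one for each family alone, with the
   same [e]. *)
have -> : \sum_b commutator (L b) (commutator (L b) (L c)) = e *: L c.
  rewrite -eigL; apply: eq_bigr => b _.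
  by rewrite RL commutator0r addr0.
have -> : \sum_b commutator (R b) (commutator (R b) (R c)) = e *: R c.
  rewrite -eigR; apply: eq_bigr => b _.
  by rewrite LR commutator0r add0r.
by rewrite scalerA mulrC -scalerA -scalerDr scalerAl.
Qed.

Hypothesis x3L : forall a, commutator (L a) x3 = 0.
Hypothesis x3R : forall a, commutator (R a) x3 = 0.
Hypothesis vx3 : commutator v x3 = s *: v.
Hypothesis vdx3 : commutator (dagger v) x3 = - s *: dagger v.

Let wx3 k a : commutator (L a + k *: R a) x3 = 0.
Proof. by rewrite commutatorDl commutatorZl x3L x3R scaler0 addr0. Qed.

(** [w b * v] and its adjoint are shifted by [x3] with opposite factors [s] and [- s], which leaves
    multiples of their commutator. That is [[w b, w' b]] times a phase, and [w b] is normal because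
    [L b] and [R b] commute. *)
Lemma twisted_axis b :
  commutator (p b) (commutator (p b) x3) +
  commutator (q b) (commutator (q b) x3) = 0.
Proof.
apply: (scalerI n2); rewrite -double_commutator_pair pq pq' scaler0.
have -> : commutator ((L b + 'i *: R b) * v) x3 = s *: (w b * v).
  by rewrite commutatorMl // vx3 scalerAr.
have -> : commutator ((L b - 'i *: R b) * dagger v) x3 =
    - s *: (w' b * dagger v).
  by rewrite commutatorMl -?scaleNr // vdx3 scalerAr w'E.
rewrite !commutatorZr (commutatorC (_ * dagger v)).
rewrite (@commutatorM _ _ (w b) (w' b)) //; last exact/commutator_eq0_sym.
rewrite w'E commutator_ww !commutatorxx scaler0 addr0 mul0r.
by rewrite oppr0 !scaler0 addr0.
Qed.

Lemma axis_twisted c :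
  commutator x3 (commutator x3 ((L c + 'i *: R c) * v)) =
  s ^+ 2 *: ((L c + 'i *: R c) * v).
Proof.
have E : commutator x3 ((L c + 'i *: R c) * v) =
    - s *: ((L c + 'i *: R c) * v).
  by rewrite commutatorC commutatorMl // vx3 -scalerAr scaleNr.
by rewrite E commutatorZr E scalerA mulrNN expr2.
Qed.

End TwistedSpheres.

(** * Time derivatives of the phases *)

Section Waves.
Context {R : realType} {A : starAlgType R[i]}.

Lemma conj_expi (x : R) : (expi x)^*%R = expi (- x).
Proof. by rewrite /expi cosN sinN. Qed.

Lemma expi_mulC (x : R) : expi x * (expi x)^*%R = 1.
Proof.
rewrite conj_expi /expi cosN sinN; apply/eqP.
rewrite eq_complex /= !mulrN opprK -!expr2 cos2Dsin2 eqxx /=.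
by rewrite mulrC addrC subrr.
Qed.

Lemma expi0 : expi 0 = 1 :> R[i].
Proof. by rewrite /expi cos0 sin0. Qed.

Lemma is_derive_expi (w t : R) :
  is_derive_complex (fun s => expi (w * s)) t ('i * w%:C * expi (w * t)).
Proof.
rewrite /is_derive_complex -complexiE /expi /=.
have dw : is_derive t 1 ( *%R w) w.
  rewrite (_ : *%R w = w \*: (id : R -> R))//.
  by apply: is_derive_eq; rewrite /GRing.scale /= mulr1.
split.
  have := @is_derive1_comp R cos ( *%R w) t _ _ (is_derive_cos _) dw.
  move=> h; apply: is_derive_eq.
  by ring.
have := @is_derive1_comp R sin ( *%R w) t _ _ (is_derive_sin _) dw.
move=> h; apply: is_derive_eq.
by ring.
Qed.

(** Two opposite frequencies appear because a Hermitian component mixes [Z] with [dagger Z]. The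
    derivative has the same shape with new amplitudes, so the lemma can be iterated. *)
Lemma is_time_derivative_wave (w : R) (M N : A) :
  is_time_derivative
    (fun t => expi (w * t) *: M + expi (- w * t) *: N)
    (fun t => expi (w * t) *: (('i * w%:C) *: M) +
              expi (- w * t) *: (('i * (- w)%:C) *: N)).
Proof.
pose W (k : 'I_2) := if k == ord0 then w else - w.
exists 2%N, (fun k t => expi (W k * t)),
  (fun k t => 'i * (W k)%:C * expi (W k * t)),
  (fun k => if k == ord0 then M else N); split=> [k t|t|t].
- exact: is_derive_expi.
- by rewrite !big_ord_recl big_ord0 addr0.
- by rewrite !big_ord_recl big_ord0 addr0 /= !scalerA ![expi _ * _]mulrC.
Qed.

(** Both modes acquire the same factor, the square of ['i * w] or of [- 'i * w]. *)
Lemma is_second_time_derivative_wave (w : R) (M N : A) (X : R -> A) :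
  (forall t, X t = expi (w * t) *: M + expi (- w * t) *: N) ->
  is_second_time_derivative X (fun t => - (w ^+ 2)%:C *: X t).
Proof.
move=> XE; have -> : X = fun t => expi (w * t) *: M + expi (- w * t) *: N.
  exact/funext.
eexists; split; first exact: is_time_derivative_wave.
have := is_time_derivative_wave w (('i * w%:C) *: M) (('i * (- w)%:C) *: N).
congr is_time_derivative; apply/funext => t.
have sq (u : R) : 'i * u%:C * ('i * u%:C) = - (u ^+ 2)%:C :> R[i].
  by rewrite mulrACA -expr2 sqrCi mulN1r rmorphXn expr2.
rewrite ![('i * _) *: _]scalerA !sq sqrrN scalerDr !scalerA.
by rewrite ![expi _ * _]mulrC.
Qed.

Lemma is_second_time_derivative_cst (M : A) (X : R -> A) :
  (forall t, X t = M) -> is_second_time_derivative X (fun=> 0).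
Proof.
move=> XE; rewrite (_ : (fun=> 0) = fun t => - (0 ^+ 2 : R)%:C *: X t).
  (* A constant is a wave of frequency 0 whose second amplitude vanishes. *)
  apply: (@is_second_time_derivative_wave 0 M 0) => t.
  by rewrite XE mul0r expi0 scale1r scaler0 addr0.
by apply/funext => t; rewrite expr0n rmorph0 oppr0 scale0r.
Qed.

End Waves.

(** * The nine indices as three single ones and three pairs *)

Lemma sum_ord9 (V : nmodType) (F : 'I_9 -> V) :
  \sum_k F k = F (inord 0) + F (inord 1) + F (inord 2) +
  \sum_(a < 3) (F (inord (2 * a + 3)) + F (inord (2 * a + 4))).
Proof.
transitivity (\sum_(k < 9) F (inord k)).
  by apply: eq_bigr => k _; rewrite inord_val.
by rewrite !big_ord_recl !big_ord0 /= !addr0 !addrA.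
Qed.

(** Both [a] and the matrix index count from 0 here, so the pairs [2 * a + 3], [2 * a + 4] run
    through the indices 3 to 8. *)
Lemma ord9_ind (P : 'I_9 -> Prop) :
  P (inord 0) -> P (inord 1) -> P (inord 2) ->
  (forall a : 'I_3, P (inord (2 * a + 3)) /\ P (inord (2 * a + 4))) ->
  forall k, P k.
Proof.
move=> P0 P1 P2 Pa k; rewrite -(inord_val k).
have [P3 P4] := Pa (inord 0); have [P5 P6] := Pa (inord 1).
have [P7 P8] := Pa (inord 2); move: P3 P4 P5 P6 P7 P8; rewrite !inordK //.
by case: k; do 9 case=> //.
Qed.

(** * The equations of motion *)

Theorem mainTheorem7 (R : realType) (A : starAlgType R[i])
  (YL YR : 'I_3 -> A) (cL cR rL rR xi theta omega : R)
  (U3 X1 X2 X3 : A) (X : 'I_9 -> R -> A)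
  (sphereL : fuzzy_sphere cL rL YL)
  (sphereR : fuzzy_sphere cR rR YR)
  (spheres_comm : commuting (range YL) (range YR))
  (sphere_eigL : forall a,
     \sum_b (commutator (YL b) (commutator (YL b) (YL a))
             + commutator (YR b) (commutator (YR b) (YL a)))
     = (xi ^+ 2)%:C *: YL a)
  (sphere_eigR : forall a,
     \sum_b (commutator (YL b) (commutator (YL b) (YR a))
             + commutator (YR b) (commutator (YR b) (YR a)))
     = (xi ^+ 2)%:C *: YR a)
  (cylinder : fuzzy_cylinder 1 xi U3 X3)
  (herm1 : is_hermitian X1) (herm2 : is_hermitian X2)
  (plane : commutator X1 X2 = ('i * theta%:C)%:A)
  (sphere_cylinder : commuting (range YL `|` range YR) [set U3; X3])
  (sphere_plane : commuting (range YL `|` range YR) [set X1; X2])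
  (cylinder_plane : commuting [set U3; X3] [set X1; X2])
  (omega_sq : omega ^+ 2 = 2 * xi ^+ 2)
  (X_herm : forall k t, is_hermitian (X k t))
  (X_1 : forall t, X (inord 0) t = X1)
  (X_2 : forall t, X (inord 1) t = X2)
  (X_3 : forall t, X (inord 2) t = X3)
  (X_YU : forall (a : 'I_3) t,
     X (inord (2 * a + 3)%N) t + 'i *: X (inord (2 * a + 4)%N) t
     = expi (omega * t) *: ((YL a + 'i *: YR a) * U3)) :
  solves_BFSS X.
Proof.
have [hL _ _] := sphereL; have [hR _ _] := sphereR.
have [_ hx3 [UUd UdU] Ux3 Udx3] := cylinder.
have LR a b : commutator (YL a) (YR b) = 0.
  by apply: spheres_comm; [exists a|exists b].
have LS a : (range YL `|` range YR) (YL a) by left; exists a.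
have RS a : (range YL `|` range YR) (YR a) by right; exists a.
have sU := sphere_cylinder _ U3 _ (or_introl erefl).
have s3 := sphere_cylinder _ X3 _ (or_intror erefl).
have s1 := sphere_plane _ X1 _ (or_introl erefl).
have s2 := sphere_plane _ X2 _ (or_intror erefl).
have U1 := cylinder_plane U3 X1 (or_introl erefl) (or_introl erefl).
have U2 := cylinder_plane U3 X2 (or_introl erefl) (or_intror erefl).
have x31 := cylinder_plane X3 X1 (or_intror erefl) (or_introl erefl).
have x32 := cylinder_plane X3 X2 (or_intror erefl) (or_intror erefl).
(* With the phase absorbed into the cylinder matrix, the time-independent results on twisted spheres
   apply at each fixed [t]. *)
pose v t := expi (omega * t) *: U3.
pose Z a t := (YL a + 'i *: YR a) * v t.
pose p (a : 'I_3) t := X (inord (2 * a + 3)) t.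
pose q (a : 'I_3) t := X (inord (2 * a + 4)) t.
have pq t a : p a t + 'i *: q a t = Z a t by rewrite X_YU /Z /v -scalerAr.
have vd t : dagger (v t) = (expi (omega * t))^* *: dagger U3 by rewrite daggerZ.
have vvd t : v t * dagger (v t) = 1.
  by rewrite vd -scalerAl -scalerAr scalerA expi_mulC UUd expr1n !scale1r.
have vdv t : dagger (v t) * v t = 1.
  by rewrite vd -scalerAl -scalerAr scalerA mulrC expi_mulC UdU expr1n !scale1r.
have vL t a : commutator (v t) (YL a) = 0.
  by rewrite commutatorZl (commutator_eq0_sym _ _ (sU _ (LS a))) scaler0.
have vR t a : commutator (v t) (YR a) = 0.
  by rewrite commutatorZl (commutator_eq0_sym _ _ (sU _ (RS a))) scaler0.
have ZdE t a : dagger (Z a t) = (YL a - 'i *: YR a) * dagger (v t).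
  exact: dagger_twisted.
have pq' t a : p a t - 'i *: q a t = dagger (Z a t).
  by rewrite -pq daggerD daggerZ !X_herm conjCi scaleNr.
(* Both components are combinations of [Z] and [dagger Z], so by linearity it is enough to treat
   these two. *)
have parts t a : p a t = 2^-1 *: (Z a t + dagger (Z a t)) /\
    q a t = (2 * 'i)^-1 *: (Z a t - dagger (Z a t)).
  apply/hermitian_decomposition.
  by split; [exact: X_herm|split; [exact: X_herm|]].
pose box t M := \sum_b commutator (X b t) (commutator (X b t) M).
have boxE t M : box t M = commutator X1 (commutator X1 M) +
    commutator X2 (commutator X2 M) + commutator X3 (commutator X3 M) +
    \sum_a (commutator (p a t) (commutator (p a t) M) +
            commutator (q a t) (commutator (q a t) M)).
  by rewrite /box sum_ord9 X_1 X_2 X_3.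
have boxD t M N : box t (M + N) = box t M + box t N.
  rewrite /box -big_split; apply: eq_bigr => b _.
  by rewrite (commutatorDr _ M) commutatorDr.
have boxZ t k M : box t (k *: M) = k *: box t M.
  rewrite /box scaler_sumr; apply: eq_bigr => b _.
  by rewrite (commutatorZr k _ M) commutatorZr.
have boxN t M : box t (- M) = - box t M.
  by rewrite -scaleN1r boxZ scaleN1r.
(* Each of the two nested commutators with a Hermitian matrix contributes a sign under the adjoint,
   and the signs cancel. The value of [box] at [dagger Z] then follows from that at [Z]. *)
have box_dagger t M : dagger (box t M) = box t (dagger M).
  rewrite /box dagger_sum; apply: eq_bigr => b _.
  by rewrite !dagger_commutator !X_herm commutatorNr opprK.
have plane_Z x t a : is_hermitian x -> commutator U3 x = 0 ->
    (forall y, (range YL `|` range YR) y -> commutator y x = 0) ->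
    commutator (Z a t) x = 0 /\ commutator (dagger (Z a t)) x = 0.
  move=> hx Ux sx; suff Zx : commutator (Z a t) x = 0.
    split=> //; apply/commutator_eq0_sym/dagger_commutator_eq0 => //.
    exact/commutator_eq0_sym.
  rewrite commutatorMl; first by rewrite commutatorZl Ux scaler0 mulr0.
  by rewrite commutatorDl commutatorZl !sx // scaler0 addr0.
have plane_pq x t a : is_hermitian x -> commutator U3 x = 0 ->
    (forall y, (range YL `|` range YR) y -> commutator y x = 0) ->
    commutator (p a t) x = 0 /\ commutator (q a t) x = 0.
  move=> hx Ux sx; have [Zx Zdx] := plane_Z x t a hx Ux sx.
  have [-> ->] := parts t a.
  rewrite !commutatorZl !commutatorDl commutatorNl Zx Zdx.
  by rewrite oppr0 addr0 !scaler0.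
(* [[X1, X2]] is a scalar multiple of 1, hence central. *)
have x12 : commutator X1 (commutator X1 X2) = 0 by rewrite plane commutatorA1.
have x21 : commutator X2 (commutator X2 X1) = 0.
  by rewrite (commutatorC X2 X1) plane commutatorNr commutatorA1 oppr0.
have box1 t : box t X1 = 0.
  rewrite boxE x21 commutatorxx x31 !commutator0r !addr0 add0r big1// => a _.
  by have [-> ->] := plane_pq X1 t a herm1 U1 s1; rewrite !commutator0r addr0.
have box2 t : box t X2 = 0.
  rewrite boxE x12 commutatorxx x32 !commutator0r !addr0 add0r big1// => a _.
  by have [-> ->] := plane_pq X2 t a herm2 U2 s2; rewrite !commutator0r addr0.
have vx3 t : commutator (v t) X3 = xi%:C *: v t.
  by rewrite commutatorZl Ux3 !scalerA mulrC.
have vdx3 t : commutator (dagger (v t)) X3 = - xi%:C *: dagger (v t).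
  by rewrite vd commutatorZl Udx3 !scalerA mulrC.
have box3 t : box t X3 = 0.
  rewrite boxE commutatorxx (commutator_eq0_sym _ _ x31).
  rewrite (commutator_eq0_sym _ _ x32) !commutator0r !addr0 add0r big1// => a _.
  apply: (@twisted_axis _ _ _ YL YR (v t) X3 xi%:C
    _ _ _ _ _ _ _ (p^~ t) (q^~ t)) => // b.
  - by rewrite pq' ZdE.
  - exact: s3.
  - exact: s3.
have boxZt t a : box t (Z a t) = (omega ^+ 2)%:C *: Z a t.
  rewrite boxE (@axis_twisted _ _ _ YL YR (v t) X3 xi%:C) //; last 2 first.
  - by move=> b; exact: s3.
  - by move=> b; exact: s3.
  rewrite (@twisted_eigen _ _ _ YL YR (v t) (xi ^+ 2)%:C) //; last first.
    by move=> b; rewrite pq' ZdE.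
  have [Z1 _] := plane_Z X1 t a herm1 U1 s1.
  have [Z2 _] := plane_Z X2 t a herm2 U2 s2.
  rewrite (commutator_eq0_sym _ _ Z1) (commutator_eq0_sym _ _ Z2).
  (* The axis [X3] gives [xi ^+ 2] and the six twisted matrices together give another [xi ^+ 2]; the
     sum is [omega ^+ 2]. *)
  rewrite !commutator0r !add0r -scalerDl omega_sq -rmorphXn -rmorphD.
  by rewrite mulr_natl mulr2n.
have boxZdt t a : box t (dagger (Z a t)) = (omega ^+ 2)%:C *: dagger (Z a t).
  by rewrite -box_dagger boxZt daggerZ conj_Creal // complex_real.
(* The scalar [k] will be the prefactor [2^-1] of [p] or [(2 * 'i)^-1] of [q]. *)
have box_solve t k M : box t M = (omega ^+ 2)%:C *: M ->
    - (omega ^+ 2)%:C *: (k *: M) + box t (k *: M) = 0.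
  by move=> h; rewrite boxZ h !scalerA -scalerDl mulNr mulrC addNr scale0r.
have solve k : exists D : R -> A, is_second_time_derivative (X k) D /\
    forall t, D t + box t (X k t) = 0.
  elim/ord9_ind: k => [|||a].
  - exists (fun=> 0); split; first exact: is_second_time_derivative_cst.
    by move=> t; rewrite X_1 box1 addr0.
  - exists (fun=> 0); split; first exact: is_second_time_derivative_cst.
    by move=> t; rewrite X_2 box2 addr0.
  - exists (fun=> 0); split; first exact: is_second_time_derivative_cst.
    by move=> t; rewrite X_3 box3 addr0.
  have Zw t : Z a t = expi (omega * t) *: ((YL a + 'i *: YR a) * U3).
    by rewrite -pq X_YU.
  have Zdw t : dagger (Z a t) =
      expi (- omega * t) *: dagger ((YL a + 'i *: YR a) * U3).
    by rewrite Zw daggerZ conj_expi mulNr.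
  split; eexists; split.
  (* The amplitudes, found by unification, are half of [(YL a + 'i *: YR a) * U3] and half of its
     adjoint. *)
  - apply: (@is_second_time_derivative_wave _ _ omega) => t.
    rewrite -/(p a t) (proj1 (parts t a)) Zdw Zw scalerDr.
    by rewrite !(scalerA 2^-1) !(mulrC 2^-1) -!scalerA.
  - move=> t /=; rewrite -/(p a t) (proj1 (parts t a)) box_solve //.
    by rewrite boxD boxZt boxZdt -scalerDr.
  - apply: (@is_second_time_derivative_wave _ _ omega) => t.
    rewrite -/(q a t) (proj2 (parts t a)) Zdw Zw -scalerN scalerDr.
    by rewrite !(scalerA (2 * 'i)^-1) !(mulrC (2 * 'i)^-1) -!scalerA.
  - move=> t /=; rewrite -/(q a t) (proj2 (parts t a)) box_solve //.
    by rewrite boxD boxN boxZt boxZdt -scalerBr.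
have [D DP] := choice solve.
exists D; split=> [a|a t]; first by have [] := DP a.
by have [_] := DP a; exact.
Qed.
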